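(* Let $\mathcal{A}$ be a finite family in $\mathbb{R}^{2\times2}$ and let $$\mathcal{A}_1=\mathcal{A}\cup\{A_iA_j : A_i,A_j\in\mathcal{A},\ \det A_i<0,\ \det A_j<0,\ A_iA_j\neq cI \text{ for every scalar } c\}.$$ For an $\mathcal{A}$-invariant proper cone to exist it is necessary that all of the following hold: (i) all elements of $\mathcal{A}_1$ are Vandergraft matrices; (ii) there are at most two dominant eigenlines corresponding to non-diagonalizable matrices in $\mathcal{A}_1$, and all the non-diagonalizable matrices in $\mathcal{A}_1$ (if there is more than one) corresponding to the same dominant eigenline also have the same orientation; (iii) the dominant eigenlines of matrices in $\mathcal{A}_1$ are separated from the non-dominant ones.
   Context: All matrices are real. A set $\mathcal{K}\subseteq\mathbb{R}^n$ is a cone if $a\mathcal{K}\subseteq\mathcal{K}$ for all $a\ge 0$; a cone is proper if it is convex ($\mathcal{K}+\mathcal{K}\subseteq\mathcal{K}$), closed, pointed ($\mathcal{K}\cap-\mathcal{K}=\{0\}$) and solid (nonempty interior). $\mathcal{K}$ is $A$-invariant if $Ax\in\mathcal{K}$ for all $x\in\mathcal{K}$, and $\mathcal{A}$-invariant if it is $A$-invariant for every $A\in\mathcal{A}$. $\operatorname{Cone}X$ is the set of all finite linear combinations of elements of $X$ with non-negative coefficients. The indices $i=j$ are allowed in the definition of $\mathcal{A}_1$. A real $n\times n$ matrix $A$ is a Vandergraft matrix if (1) its spectral radius $\rho(A)$ is an eigenvalue of $A$, and (2) $\deg\rho(A)\ge\deg\lambda$ for every eigenvalue $\lambda$ with $|\lambda|=\rho(A)$,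 where $\deg\lambda$ is the multiplicity of $\lambda$ as a root of the minimal polynomial of $A$. For a $2\times 2$ Vandergraft matrix that is not a scalar multiple of $I$, the (one-dimensional) eigenspace for $\rho(A)$ is its dominant eigenline and the nonzero vectors in it are dominant eigenvectors; if $A$ has a second eigenvalue different from $\rho(A)$, the corresponding eigenspace is its non-dominant eigenline, with non-dominant eigenvectors the nonzero vectors in it. Scalar matrices contribute no eigenlines. If $A\in\mathbb{R}^{2\times2}$ is a non-diagonalizable Vandergraft matrix with eigenvalue $\lambda$ and eigenvector $u$, then every $v\in\mathbb{R}^2$ satisfies $Av=\lambda v+xu$ for a unique $x\in\mathbb{R}$; $v$ is positively (negatively) associated with $u$ relative to $A$ if $x>0$ ($x<0$). Non-diagonalizable matrices sharing the eigenvector $u$ have the same orientation if the sets of vectors positively associated with $u$ relative to these matrices coincide. Separation in (iii) means: there exist linearly independent vectors $v_1,v_2\in\mathbb{R}^2$ such that the interior of $\operatorname{Cone}\{v_1,v_2\}$ is free of the non-dominant eigenvectors of matrices in $\mathcal{A}_1$, while the interior of $\operatorname{Cone}\{v_1,-v_2\}$ is free of the dominant eigenvectors of non-scalar matrices in $\mathcal{A}_1$; moreover, each $v_j$ is allowed to be both a dominant eigenvector (of some non-scalar matrix in $\mathcal{A}_1$) and a non-dominant eigenvector (of some matrix in $\mathcal{A}_1$) only if all the matrices in $\mathcal{A}_1$ of which it is a non-dominant eigenvector have non-negative determinant. *)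

(* Defs.v *)
From HB Require Import structures.
From mathcomp Require Export all_boot all_order all_algebra.
From mathcomp Require Export all_classical all_reals all_analysis.
From mathcomp Require Export complex.
Export numFieldNormedType.Exports.
Set Implicit Arguments.
Unset Strict Implicit.
Unset Printing Implicit Defensive.
Import Order.TTheory GRing.Theory Num.Theory.
Local Open Scope classical_set_scope.
Local Open Scope ring_scope.

(* Vectors are columns and matrices act on the left, [A *m x].  MathComp's
   [eigenvalue] and [mxminpoly] are used as they are: [eigenvalue] is phrased
   with row vectors, but a square matrix has the same left and right
   eigenvalues. *)

Definition is_cone (R : realType) (n : nat) (K : set 'cV[R]_n) : Prop :=
  forall a : R, 0 <= a -> forall x, K x -> K (a *: x).

Record proper_cone (R : realType) (n : nat) (K : set 'cV[R]_n) : Prop :=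
  ProperCone {
    proper_is_cone : is_cone K ;
    proper_convex : forall x y, K x -> K y -> K (x + y) ;
    proper_closed : closed K ;
    proper_pointed : K `&` [set - x | x in K] = [set 0] ;
    proper_solid : K° !=set0 }.

Definition invariant (R : realType) (n : nat)
    (A : 'M[R]_n) (K : set 'cV[R]_n) : Prop :=
  forall x, K x -> K (A *m x).

Definition family_invariant (R : realType) (n : nat)
    (F : set 'M[R]_n) (K : set 'cV[R]_n) : Prop :=
  forall A, F A -> invariant A K.

Definition Cone (R : realType) (n : nat) (X : set 'cV[R]_n) : set 'cV[R]_n :=
  [set x | exists (m : nat) (a : 'I_m -> R) (y : 'I_m -> 'cV[R]_n),
    [/\ forall i, 0 <= a i, forall i, X (y i) & x = \sum_(i < m) a i *: y i]].

Definition complexify (R : realType) (n : nat) (A : 'M[R]_n) : 'M[R[i]]_n :=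
  map_mx (real_complex R) A.

(* [normc] is the real-valued modulus.  For n > 0 the set below is finite and
   nonempty, so the supremum is a maximum. *)
Definition spectral_radius (R : realType) (n : nat) (A : 'M[R]_n) : R :=
  sup [set Normc.normc z | z in [set z : R[i] | eigenvalue (complexify A) z]].

Definition eig_deg (R : realType) (n : nat) (A : 'M[R]_n.+1) (z : R[i]) : nat :=
  mup z (map_poly (real_complex R) (mxminpoly A)).

Definition vandergraft (R : realType) (n : nat) (A : 'M[R]_n.+1) : Prop :=
  let rho : R[i] := real_complex R (spectral_radius A) in
  eigenvalue (complexify A) rho /\
  (forall z : R[i], eigenvalue (complexify A) z ->
     Normc.normc z = spectral_radius A -> (eig_deg A z <= eig_deg A rho)%N).

Definition dominant_eigenline (R : realType) (A : 'M[R]_2) : set 'cV[R]_2 :=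
  [set v | A *m v = spectral_radius A *: v].

Definition dominant_eigenvector (R : realType) (A : 'M[R]_2) (v : 'cV[R]_2)
    : Prop :=
  [/\ vandergraft A, ~~ is_scalar_mx A, v != 0 & dominant_eigenline A v].

(* The second eigenvalue of a Vandergraft 2 x 2 matrix is real, since the trace
   and the spectral radius are. *)
Definition nondominant_eigenvector (R : realType) (A : 'M[R]_2) (v : 'cV[R]_2)
    : Prop :=
  [/\ vandergraft A, ~~ is_scalar_mx A, v != 0 &
      exists mu : R, mu != spectral_radius A /\ A *m v = mu *: v].

(* Intended for a non-diagonalizable [A] with eigenvector [u]; then [lam] is
   its only eigenvalue and [x] is determined by [v]. *)
Definition positively_associated (R : realType) (A : 'M[R]_2) (u : 'cV[R]_2)
    : set 'cV[R]_2 :=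
  [set v | exists lam x : R,
    [/\ A *m u = lam *: u, A *m v = lam *: v + x *: u & 0 < x]].

Definition same_orientation (R : realType) (u : 'cV[R]_2) (A B : 'M[R]_2)
    : Prop :=
  positively_associated A u = positively_associated B u.

Definition family1 (R : realType) (F : set 'M[R]_2) : set 'M[R]_2 :=
  F `|` [set M | exists A B : 'M[R]_2,
           [/\ F A, F B, \det A < 0 /\ \det B < 0,
               M = A *m B & ~~ is_scalar_mx (A *m B)]].

Definition nondiagonalizable_in (R : realType) (G : set 'M[R]_2)
    : set 'M[R]_2 :=
  [set A | G A /\ ~ diagonalizable A].

Definition separated (R : realType) (G : set 'M[R]_2) : Prop :=
  exists v1 v2 : 'cV[R]_2,
    [/\ free [:: v1; v2],
        forall A v, G A -> nondominant_eigenvector A v ->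
          ~ (Cone [set v1; v2])° v,
        forall A v, G A -> dominant_eigenvector A v ->
          ~ (Cone [set v1; - v2])° v
      & forall v, v = v1 \/ v = v2 ->
          (exists A, G A /\ dominant_eigenvector A v) /\
          (exists A, G A /\ nondominant_eigenvector A v) ->
          forall A, G A -> nondominant_eigenvector A v -> 0 <= \det A].

(* Main.v *)
(** In the plane a proper cone is spanned by two extreme rays [v1], [v2]: cut it
    with the two lines [q + R p] and [- q + R p] through an interior direction
    [p].  In the basis [v1], [v2] every matrix leaving the cone invariant becomes
    entrywise nonnegative, hence has real eigenvalues [r >= `|m|].  It is
    non-diagonalizable only when it is a shear along an axis, which leaves two
    possible eigenlines and one orientation for each.  Comparing the
    diagonal entries with [r] and [m] through the eigenvector equation excludes
    dominant eigenvectors with coordinates of opposite signs and non-dominant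
    ones with coordinates of the same sign, so [v1] and [v2] separate them.
    If [v_j] is a non-dominant eigenvector, its eigenvalue is a diagonal entry, so
    both eigenvalues, and hence the determinant, are nonnegative. *)

Require Import Defs.
From mathcomp Require Import ring lra.
Import Order.TTheory GRing.Theory Num.Theory.
Local Open Scope classical_set_scope.
Local Open Scope card_scope.
Local Open Scope ring_scope.
Set Implicit Arguments.
Unset Strict Implicit.
Unset Printing Implicit Defensive.

(** * Proper cones and the lines that cross them *)

Lemma nbhs_ray (R : realType) (V : normedModType R) (U : set V) (x w : V) :
  nbhs x U -> exists2 t : R, 0 < t & U (x + t *: w).
Proof.
move=> /nbhs_normP[e /= e0 xU]; have w0 := normr_ge0 w.
(* The [+ 1] keeps the denominator positive when [w = 0]. *)
exists (e / (`|w| + 1)); first by rewrite divr_gt0// ltr_wpDl.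
apply: xU => /=; rewrite opprD addNKr normrN normrZ gtr0_norm ?divr_gt0 ?ltr_wpDl//.
by rewrite mulrAC ltr_pdivrMr ?ltr_wpDl// ltr_pM2l// ltrDl.
Qed.

Section ProperCone.
Variables (R : realType) (n : nat) (K : set 'cV[R]_n).
Hypothesis properK : proper_cone K.

Let coneZ a x : 0 <= a -> K x -> K (a *: x).
Proof. by move=> a0; apply: (proper_is_cone properK a0). Qed.

Lemma proper_coneZ a x : 0 < a -> K (a *: x) <-> K x.
Proof.
move=> a0; split=> [Kax|]; last exact/coneZ/ltW.
rewrite -(scale1r x) -(mulVf (lt0r_neq0 a0)) -scalerA.
by apply: coneZ; rewrite // invr_ge0 ltW.
Qed.

Lemma proper_cone0 : K 0.
Proof.
have [x /interior_subset Kx] := proper_solid properK.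
by rewrite -(scale0r x); apply: coneZ.
Qed.

Lemma proper_cone_opp x : K x -> K (- x) -> x = 0.
Proof.
move=> Kx KNx; have : (K `&` [set - x | x in K]) x.
  by split=> //; exists (- x); rewrite ?opprK.
by rewrite (proper_pointed properK).
Qed.

(** If [- p] were in [K], pointedness would give [p = 0]. A cone with 0 in its interior is the whole
    space, which is not pointed when [n > 0]. *)
Lemma proper_cone_interiorN p : (0 < n)%N -> K° p -> ~ K (- p).
Proof.
move=> n0 Kp KNp; have p0 := proper_cone_opp (interior_subset Kp) KNp.
have KT w : K w.
  have [t t0] := nbhs_ray w Kp.
  by rewrite p0 add0r proper_coneZ.
have /matrixP/(_ (Ordinal n0) 0) := proper_cone_opp (KT (const_mx 1)) (KT _).
by rewrite !mxE => /eqP; rewrite oner_eq0.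
Qed.

(** Adding nonnegative multiples of [p] never leaves [K], so the admissible [t] form an up-set. It
    is nonempty because [p] is interior, and bounded below because [- p] lies in the open complement
    of [K]. Closedness puts its infimum in it. *)
Lemma proper_cone_line p q : (0 < n)%N -> K° p ->
  exists t0, forall t, K (q + t *: p) <-> t0 <= t.
Proof.
move=> n0 Kp; have Kp' := interior_subset Kp.
have up s t : s <= t -> K (q + s *: p) -> K (q + t *: p).
  move=> st Ks.
  rewrite [X in K X](_ : _ = (q + s *: p) + (t - s) *: p); last first.
    by rewrite -addrA -scalerDl subrKC.
  by apply: (proper_convex properK) => //; apply: coneZ; rewrite // subr_ge0.
pose S := [set t | K (q + t *: p)].
have S0 : S !=set0.
  have [t t0 Kt] := nbhs_ray q Kp; exists t^-1.
  by apply/(proper_coneZ _ t0); rewrite scalerDr scalerA divff ?lt0r_neq0// scale1r addrC.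
have oK : open (~` K) by exact/closed_openC/(proper_closed properK).
have Slb : has_lbound S.
  have [t t0 Kt] := nbhs_ray q (open_nbhs_nbhs (conj oK (proper_cone_interiorN n0 Kp))).
  exists (- t^-1) => s Ss; rewrite leNgt; apply/negP => /ltW/up/(_ Ss).
  move=> /(proper_coneZ _ t0); rewrite scalerDr scalerA mulrN divff ?lt0r_neq0//.
  by rewrite scaleN1r addrC.
exists (inf S) => t; split=> [|St]; first exact: ge_inf.
(* If the point at [inf S] were outside [K], so would be the point at [inf S + s] for some [s > 0],
   although [S] has an element below [inf S + s]. *)
apply: (up _ _ St); apply: contrapT => nS.
have [s s0] := nbhs_ray p (open_nbhs_nbhs (conj oK nS)).
rewrite -addrA -scalerDl => nSs.
have [r Sr] := inf_adherent s0 (conj S0 Slb).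
by move=> /ltW /up /(_ Sr).
Qed.

End ProperCone.

(** * Coordinates in the plane and the two edges of a proper cone *)

Lemma ord2P (i : 'I_2) : i = 0 \/ i = 1.
Proof. by case: i => [[|[|//]]] ?; [left|right]; apply/val_inj. Qed.

Lemma forall_ord2 (P : 'I_2 -> Prop) : (forall i, P i) <-> P 0 /\ P 1.
Proof. by split=> [?|[? ?] i]//; case: (ord2P i) => ->. Qed.

Lemma sum_ord2 (V : nmodType) (f : 'I_2 -> V) : \sum_i f i = f 0 + f 1.
Proof. by rewrite !big_ord_recl big_ord0 addr0; congr (_ + f _); apply/val_inj. Qed.

Lemma mulmx2E (R : pzSemiRingType) (A : 'M[R]_2) (x : 'cV[R]_2) i :
  (A *m x) i 0 = A i 0 * x 0 0 + A i 1 * x 1 0.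
Proof. by rewrite mxE sum_ord2. Qed.

Lemma det_mx2 (R : comNzRingType) (A : 'M[R]_2) :
  \det A = A 0 0 * A 1 1 - A 0 1 * A 1 0.
Proof.
rewrite (expand_det_row _ 0) sum_ord2 /cofactor !det_mx11 !mxE /= expr0 expr1 mul1r.
rewrite mulN1r mulrN; congr (_ * A _ _ - _ * A _ _); exact/val_inj.
Qed.

(** The columns of [P] are the points where the lines [q + R p] and [- q + R p] enter [K]; they span
    the two edges of the cone. *)
Lemma proper_cone_orthant (R : realType) (K : set 'cV[R]_2) : proper_cone K ->
  exists2 P : 'M[R]_2, P \in unitmx &
    forall y, K (P *m y) <-> forall i, 0 <= y i 0.
Proof.
move=> pK; have [p Kp] := proper_solid pK.
have KNp := proper_cone_interiorN pK erefl Kp.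
(* [q] is [p] turned by a right angle. *)
pose q : 'cV[R]_2 := \col_i (if i == 0 then - p 1 0 else p 0 0).
have [t1 Ht1] := proper_cone_line pK q erefl Kp.
have [t2 Ht2] := proper_cone_line pK (- q) erefl Kp.
have Kw1 := (Ht1 t1).2 (lexx _); have Kw2 := (Ht2 t2).2 (lexx _).
(* The two entry points add up to [(t1 + t2) *: p]. A negative factor would put [- p] in [K]; a zero
   factor makes the points opposite, hence zero, so [p] is parallel to its own rotation and
   vanishes. *)
have s0 : 0 < t1 + t2.
  have Ks : K ((t1 + t2) *: p).
    have := proper_convex pK Kw1 Kw2; congr (K _).
    by rewrite addrACA subrr add0r scalerDl.
  rewrite ltNge; apply/negP; rewrite le_eqVlt => /orP[/eqP s0|s0].
    have w1 : q + t1 *: p = 0.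
      apply: (proper_cone_opp pK Kw1); rewrite opprD -scaleNr.
      by have -> : - t1 = t2 by lra.
    have /matrixP e := w1; have := e 0 0; have := e 1 0; rewrite !mxE/= => e1 e0.
    apply: KNp; rewrite (_ : - p = 0); first exact: proper_cone0.
    apply/matrixP => i j; rewrite ord1 !mxE; apply/eqP; rewrite oppr_eq0; apply/eqP.
    have p1 : p 1 0 = 0.
      have : (1 + t1 ^+ 2) * p 1 0 = 0 by nra.
      by move/eqP; rewrite mulf_eq0 gt_eqF ?ltr_pwDl ?sqr_ge0//= => /eqP.
    case: (ord2P i) => ->//; rewrite p1 in e1; lra.
  by apply/KNp/(proper_coneZ pK (a := - (t1 + t2)));
    rewrite ?oppr_gt0// scaleNr scalerN opprK.
pose P : 'M[R]_2 := \matrix_(i, j) (if j == 0 then q + t1 *: p else - q + t2 *: p) i 0.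
have PE (y : 'cV[R]_2) :
    P *m y = (y 0 0 - y 1 0) *: q + (t1 * y 0 0 + t2 * y 1 0) *: p.
  apply/matrixP => i j; rewrite ord1 mulmx2E.
  by rewrite !mxE /=; ring.
have KP (y : 'cV[R]_2) : K (P *m y) <-> forall i, 0 <= y i 0.
  rewrite forall_ord2 PE; set a := y 0 0; set b := y 1 0.
  (* Dividing by [|a - b|] moves [P *m y] onto one of the two lines, where membership is a threshold
     on the coefficient of [p]. If [a = b], the vector is a multiple of [p] itself. *)
  have [ab|ab|<-] := ltgtP a b.
  - have c0 : 0 < b - a by rewrite subr_gt0.
    rewrite (_ : _ + _ = (b - a) *: (- q + ((t1 * a + t2 * b) / (b - a)) *: p)); last first.
      by rewrite scalerDr scalerA mulrCA divff ?lt0r_neq0// mulr1 scalerN -scaleNr opprB.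
    rewrite proper_coneZ// Ht2 ler_pdivlMr//.
    by split=> [|[]]; nra.
  - have c0 : 0 < a - b by rewrite subr_gt0.
    rewrite (_ : _ + _ = (a - b) *: (q + ((t1 * a + t2 * b) / (a - b)) *: p)); last first.
      by rewrite scalerDr scalerA mulrCA divff ?lt0r_neq0// mulr1.
    rewrite proper_coneZ// Ht1 ler_pdivlMr//.
    by split=> [|[]]; nra.
  - rewrite subrr scale0r add0r -mulrDl; split=> [Ka|[a0 _]]; last first.
      by apply: (proper_is_cone pK); [nra | exact: interior_subset].
    suff: 0 <= a by [].
    rewrite leNgt; apply/negP => a0; apply: KNp.
    apply/(proper_coneZ pK (a := - ((t1 + t2) * a))); first by nra.
    by rewrite scaleNr scalerN opprK.
exists P => //.
(* A vector [v] killed by [P] has both [P v] and [P (- v)] in [K], so its entries are both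
   nonnegative and nonpositive. *)
rewrite -unitmx_tr -row_free_unit; apply: inj_row_free => v vP.
have Pv : P *m v^T = 0 by rewrite -[P]trmxK -trmx_mul vP trmx0.
have K0 := proper_cone0 pK.
apply/matrixP => i j; rewrite ord1 mxE; apply/eqP; rewrite eq_le.
have := (KP v^T).1; rewrite Pv => /(_ K0 j); rewrite mxE => ->.
have := (KP (- v^T)).1; rewrite mulmxN Pv oppr0 => /(_ K0 j).
by rewrite !mxE oppr_ge0 => ->.
Qed.

(** * Spectrum of 2 x 2 matrices and the Vandergraft property *)

Lemma char_poly2 (R : fieldType) (A : 'M[R]_2) (r m : R) :
  \tr A = r + m -> \det A = r * m -> char_poly A = ('X - r%:P) * ('X - m%:P).
Proof.
move=> trA detA; have mP := char_poly_monic A; have sP := size_char_poly A.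
have -> : ('X - r%:P) * ('X - m%:P) = 'X^2 - (r + m) *: 'X + (r * m)%:P.
  by rewrite -mul_polyC polyCD polyCM; ring.
apply/polyP => -[|[|[|k]]]; rewrite !(coefD, coefN, coefZ, coefXn, coefX, coefC) /=.
- rewrite char_poly_det detA. ring.
- have /= -> := char_poly_trace A isT; rewrite trA; ring.
- have /monicP := mP; rewrite lead_coefE sP /= => ->; ring.
- by rewrite nth_default ?sP//; ring.
Qed.

(** The discriminant [(a - d)^2 + 4 b c] is nonnegative because [b] and [c] are, so the roots are
    real; their sum [a + d >= 0] makes the larger one dominate in modulus. *)
Lemma nonneg_eigenvalues2 (R : rcfType) (B : 'M[R]_2) : (forall i j, 0 <= B i j) ->
  exists r m, [/\ \tr B = r + m, \det B = r * m & `|m| <= r].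
Proof.
move=> B0; set a := B 0 0; set b := B 0 1; set c := B 1 0; set d := B 1 1.
pose s := Num.sqrt ((a - d) ^+ 2 + b * c *+ 4).
have s2 : s ^+ 2 = (a - d) ^+ 2 + b * c *+ 4.
  by rewrite sqr_sqrtr// addr_ge0 ?sqr_ge0// mulrn_wge0// mulr_ge0 ?B0.
have s0 : 0 <= s by exact: sqrtr_ge0.
have [a0 d0] : 0 <= a /\ 0 <= d by split; apply: B0.
exists ((a + d + s) / 2), ((a + d - s) / 2); split.
- by rewrite /mxtrace sum_ord2 -/a -/d; field.
- rewrite det_mx2 -/a -/b -/c -/d.
  transitivity (((a + d) ^+ 2 - s ^+ 2) / 4); last by field.
  by rewrite s2; field.
- by rewrite ler_norml; apply/andP; split; lra.
Qed.

Lemma normc_real (R : rcfType) (x : R) : Normc.normc (real_complex R x) = `|x|.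
Proof. by rewrite /Normc.normc /= expr0n addr0 sqrtr_sqr. Qed.

Section Spectrum.
Variables (R : realType) (A : 'M[R]_2) (r m : R).
Hypotheses (trA : \tr A = r + m) (detA : \det A = r * m) (mr : `|m| <= r).

Let charA := char_poly2 trA detA.

Let r0 : 0 <= r. Proof. exact: le_trans mr. Qed.

Lemma eigenvalue_complexify (z : R[i]) :
  eigenvalue (complexify A) z = (z == real_complex R r) || (z == real_complex R m).
Proof.
rewrite eigenvalue_root_char -map_char_poly charA rmorphM /= !map_polyXsubC.
by rewrite rootM !root_XsubC.
Qed.

Lemma spectral_radius2 : spectral_radius A = r.
Proof.
rewrite /spectral_radius; set S := [set _ | _ in _].
have Sr : S r.
  exists (real_complex R r); first by rewrite /= eigenvalue_complexify eqxx.
  by rewrite normc_real ger0_norm.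
have ubS : ubound S r.
  move=> _ [z /= + <-]; rewrite eigenvalue_complexify => /orP[] /eqP ->.
    by rewrite normc_real ger0_norm.
  by rewrite normc_real.
apply/eqP; rewrite eq_le; apply/andP; split; first by apply: ge_sup => //; exists r.
by apply: ub_le_sup => //; exists r.
Qed.

(** An eigenvalue other than [r] is a simple root of the characteristic polynomial, so its degree is
    at most 1, while [r] is a root of the minimal polynomial and has degree at least 1. *)
Lemma vandergraft2 : vandergraft A.
Proof.
split; first by rewrite spectral_radius2 eigenvalue_complexify eqxx.
move=> z + _; rewrite spectral_radius2 eigenvalue_complexify.
have [->//|zr /= /eqP zm] := eqVneq z (real_complex R r).
pose f := map_poly (real_complex R); pose p := f (mxminpoly A).
have p0 : p != 0 by rewrite map_poly_eq0 monic_neq0// mxminpoly_monic.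
have rp : root p (real_complex R r).
  by rewrite fmorph_root root_mxminpoly charA rootM root_XsubC eqxx.
have cp : f (char_poly A) = ('X - (real_complex R r)%:P) * ('X - z%:P).
  by rewrite /f charA rmorphM /= !map_polyXsubC zm.
have cp0 : f (char_poly A) != 0 by rewrite map_poly_eq0 monic_neq0// char_poly_monic.
apply: (@leq_trans 1%N); last by rewrite -XsubC_dvd// dvdp_XsubCl.
apply: (@leq_trans (mup z (f (char_poly A)))).
  rewrite mup_geq//; apply: (@dvdp_trans _ p); last by rewrite dvdp_map mxminpoly_dvd_char.
  by rewrite -mup_geq.
rewrite cp mupMr ?root_XsubC//.
by rewrite -[_ - _]expr1 mup_XsubCX eqxx.
Qed.

Lemma eigenvalue_col (x : 'cV[R]_2) (l : R) :
  x != 0 -> A *m x = l *: x -> l = r \/ l = m.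
Proof.
(* Transposition turns the column eigenvector into the row eigenvector that [eigenvalue] expects. *)
move=> x0 Ax; have : eigenvalue A^T l.
  apply/eigenvalueP; exists x^T; last by rewrite trmx_eq0.
  by rewrite -trmx_mul Ax linearZ.
rewrite eigenvalue_root_char (@char_poly2 _ _ r m) ?mxtrace_tr ?det_tr// rootM !root_XsubC.
by move=> /orP[] /eqP; [left|right].
Qed.

Lemma nondiagonalizable_double : ~ diagonalizable A -> r = m.
Proof.
move=> nd; apply/eqP; apply: contrapT => /negP rm; apply: nd.
apply/diagonalizableP; exists [:: r; m]; first by rewrite /= inE rm.
by rewrite !big_cons big_nil mulr1 -charA mxminpoly_dvd_char.
Qed.

End Spectrum.

(** * Change of basis and entrywise nonnegative 2 x 2 matrices *)

Lemma invmx_conjK (R : comUnitRingType) n (P A : 'M[R]_n) : P \in unitmx ->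
  P *m (invmx P *m A *m P) *m invmx P = A.
Proof. by move=> Pu; rewrite !mulmxA mulmxV// mul1mx mulmxK. Qed.

Lemma rev_ord2P (j k : 'I_2) : k = j \/ k = rev_ord j.
Proof.
by case: (ord2P j) => ->; case: (ord2P k) => ->; (try by left); right; apply/val_inj.
Qed.

Lemma rev_ord2_neq (j : 'I_2) : (j == rev_ord j) = false.
Proof. by case: (ord2P j) => ->. Qed.

(** With entries of [y] of opposite signs, each row of the eigenvector equation gives a diagonal
    entry at least [r]. The trace is at most [2 r], so both equal [r], and then the off-diagonal
    entries vanish. *)
Lemma nonneg_dominant_scalar (R : realFieldType) (B : 'M[R]_2) (r m : R) (y : 'cV[R]_2) :
  (forall i j, 0 <= B i j) -> \tr B = r + m -> m <= r ->
  B *m y = r *: y -> 0 < y 0 0 -> y 1 0 < 0 -> B = r%:M.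
Proof.
move=> B0; rewrite /mxtrace sum_ord2 => trB mr By y0 y1.
have := congr1 (fun x : 'cV_2 => x 0 0) By; have := congr1 (fun x : 'cV_2 => x 1 0) By.
rewrite !mulmx2E !mxE => e1 e0; have b0 := B0 0 1; have c0 := B0 1 0.
have ar : r <= B 0 0 by nra.
have dr : r <= B 1 1 by nra.
have [a d] : B 0 0 = r /\ B 1 1 = r by split; lra.
have b : B 0 1 = 0 by rewrite a in e0; nra.
have c : B 1 0 = 0 by rewrite d in e1; nra.
by apply/matrixP => i j; rewrite mxE; case: (ord2P i) => ->; case: (ord2P j) => ->.
Qed.

(** Here the rows bound both diagonal entries above by [m], so the trace [r + m] would be at most
    [2 m]. *)
Lemma nonneg_nondominant (R : realFieldType) (B : 'M[R]_2) (r m : R) (y : 'cV[R]_2) :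
  (forall i j, 0 <= B i j) -> \tr B = r + m -> m < r ->
  B *m y = m *: y -> 0 < y 0 0 -> 0 < y 1 0 -> False.
Proof.
move=> B0; rewrite /mxtrace sum_ord2 => trB mr By y0 y1.
have := congr1 (fun x : 'cV_2 => x 0 0) By; have := congr1 (fun x : 'cV_2 => x 1 0) By.
rewrite !mulmx2E !mxE => e1 e0; have b0 := B0 0 1; have c0 := B0 1 0.
have am : B 0 0 <= m by nra.
have dm : B 1 1 <= m by nra.
lra.
Qed.

(** The discriminant [(a - d)^2 + 4 b c] is zero with both terms nonnegative, so [a = d = r] and
    [b c = 0]. The index [j] is the column of the surviving off-diagonal entry, positive since [B]
    is not scalar. *)
Lemma nonneg_shear (R : realFieldType) (B : 'M[R]_2) (r : R) :
  (forall i j, 0 <= B i j) -> \tr B = r + r -> \det B = r * r ->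
  ~~ is_scalar_mx B ->
  exists (j : 'I_2) (b : R), 0 < b /\ B = r%:M + b *: delta_mx (rev_ord j) j.
Proof.
move=> B0; rewrite /mxtrace sum_ord2 det_mx2 => trB detB nsB.
have b0 := B0 0 1; have c0 := B0 1 0.
have bc0 : 0 <= B 0 1 * B 1 0 by rewrite mulr_ge0.
have adE : B 0 0 = B 1 1.
  apply/eqP; rewrite -subr_eq0 -sqrf_eq0 eq_le sqr_ge0 andbT.
  have : (B 0 0 + B 1 1) ^+ 2 = (r + r) ^+ 2 by rewrite trB.
  nra.
have [a d] : B 0 0 = r /\ B 1 1 = r by split; lra.
have /eqP : B 0 1 * B 1 0 = 0 by rewrite a d in detB; lra.
have rev0 : rev_ord (0 : 'I_2) = 1 by exact/val_inj.
have rev1 : rev_ord (1 : 'I_2) = 0 by exact/val_inj.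
rewrite mulf_eq0 => /orP[] /eqP z; [exists 0, (B 1 0)|exists 1, (B 0 1)].
all: rewrite ?rev0 ?rev1 lt_neqAle ?b0 ?c0 andbT; split.
all: try by apply/matrixP => i j; rewrite !mxE; case: (ord2P i) => ->;
  case: (ord2P j) => -> /=; rewrite ?a ?d ?z /=; ring.
all: apply/eqP => z'; case/is_scalar_mxP: nsB; exists r; apply/matrixP => i j.
all: by rewrite mxE; case: (ord2P i) => ->; case: (ord2P j) => ->.
Qed.

(** * Matrices leaving the cone invariant, read in its edge basis *)

Section Orthant.
Variables (R : realType) (K : set 'cV[R]_2) (P : 'M[R]_2).
Hypotheses (Pu : P \in unitmx) (KP : forall y, K (P *m y) <-> forall i, 0 <= y i 0).

Local Notation coord v := (invmx P *m v).

Let coordK (v : 'cV[R]_2) : P *m coord v = v. Proof. exact: mulKVmx. Qed.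

(** The columns of [P] lie in [K], so their images under [A] have nonnegative coordinates. *)
Lemma invariant_nonneg A : invariant A K ->
  forall i j, 0 <= (invmx P *m A *m P) i j.
Proof.
move=> AK i j; have Kj : K (P *m delta_mx j 0) by apply/KP => k; rewrite mxE ler0n.
have := AK _ Kj; rewrite -[A *m _]coordK => /KP/(_ i).
by rewrite !mulmxA -colE mxE.
Qed.

Section Matrix.
Variable A : 'M[R]_2.
Hypothesis AK : invariant A K.

Let B := invmx P *m A *m P.
Let B0 := invariant_nonneg AK.

Let AE : A = P *m B *m invmx P.
Proof. by rewrite invmx_conjK. Qed.

Let scalarB : is_scalar_mx B -> is_scalar_mx A.
Proof.
move=> /is_scalar_mxP[a Ba]; apply/is_scalar_mxP; exists a.
by rewrite AE Ba scalar_mxC mulmxK.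
Qed.

Let Bcoord (v : 'cV[R]_2) l : A *m v = l *: v -> B *m coord v = l *: coord v.
Proof. by move=> Av; rewrite /B -mulmxA coordK -mulmxA Av -scalemxAr. Qed.

Lemma invariant_eigenvalues : exists r m,
  [/\ \tr B = r + m, \det B = r * m, \tr A = r + m, \det A = r * m & `|m| <= r].
Proof.
have [r [m [tB dB mr]]] := nonneg_eigenvalues2 B0; exists r, m; split=> //.
  by rewrite AE mxtrace_mulC mulKmx.
by rewrite AE (det_mulmx _ (invmx P)) (det_mulmx P B) dB det_inv mulrAC divrr ?mul1r.
Qed.

Lemma invariant_vandergraft : vandergraft A.
Proof. by have [r [m [_ _ tA dA mr]]] := invariant_eigenvalues; apply: vandergraft2 mr. Qed.

Lemma invariant_dominant (v : 'cV[R]_2) : ~~ is_scalar_mx A -> dominant_eigenline A v ->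
  ~ (0 < coord v 0 0 /\ coord v 1 0 < 0).
Proof.
have [r [m [tB _ tA dA mr]]] := invariant_eigenvalues.
move=> nsA /Bcoord; rewrite (spectral_radius2 tA dA mr) => Bv [v0 v1].
move/negP: nsA; apply; apply: scalarB.
by rewrite /B (nonneg_dominant_scalar B0 tB (ler_normlW mr) Bv v0 v1) scalar_mx_is_scalar.
Qed.

Lemma invariant_nondominant (v : 'cV[R]_2) : nondominant_eigenvector A v ->
  ~ (0 < coord v 0 0 /\ 0 < coord v 1 0).
Proof.
have [r [m [tB _ tA dA mr]]] := invariant_eigenvalues.
case=> _ _ v0 [mu []]; rewrite (spectral_radius2 tA dA mr) => mur Av [].
have [mur'|mum] := eigenvalue_col tA dA v0 Av; first by rewrite mur' eqxx in mur.
move: mur Av; rewrite mum => mr' /Bcoord; apply: nonneg_nondominant tB _ => //.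
by rewrite lt_neqAle mr' ler_normlW.
Qed.

(** The coordinates of [col j P] form the [j]-th basis vector, so the non-dominant eigenvalue is the
    diagonal entry [B j j], which is nonnegative, as is [r]. *)
Lemma invariant_nondominant_edge j :
  nondominant_eigenvector A (col j P) -> 0 <= \det A.
Proof.
have [r [m [tB _ tA dA mr]]] := invariant_eigenvalues.
case=> _ _ v0 [mu []]; rewrite (spectral_radius2 tA dA mr) => mur Av.
have [mur'|mum] := eigenvalue_col tA dA v0 Av; first by rewrite mur' eqxx in mur.
rewrite dA mulr_ge0 ?(le_trans _ mr)//.
have /matrixP/(_ j 0) := Bcoord Av.
rewrite colE mulKmx// -colE [LHS]mxE [RHS]mxE [X in _ * X]mxE !eqxx mulr1 mum => <-.
exact: B0.
Qed.

Lemma invariant_shear : ~ diagonalizable A ->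
  exists (j : 'I_2) (b : R), 0 < b /\ forall v : 'cV[R]_2,
    A *m v = spectral_radius A *: v + (b * coord v j 0) *: col (rev_ord j) P.
Proof.
move=> nd; have [r [m [tB dB tA dA mr]]] := invariant_eigenvalues.
have nsB : ~~ is_scalar_mx B.
  apply/negP => /scalarB /is_scalar_mxP[a Aa]; apply: nd.
  by rewrite Aa; exact: diagonalizable_scalar.
rewrite (spectral_radius2 tA dA mr); move: tB dB.
rewrite -(nondiagonalizable_double tA dA nd) => tB dB.
have [j [b [b0 BE]]] := nonneg_shear B0 tB dB nsB; exists j, b; split=> // v.
rewrite {1}AE /B BE -!mulmxA mulmxDl mulmxDr mul_scalar_mx -scalemxAr coordK.
congr (_ + _); rewrite -scalemxAl -scalemxAr -scalerA; congr (_ *: _).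
rewrite colE scalemxAr; congr (_ *m _).
apply/matrixP => i k; rewrite ord1 mulmx2E !mxE.
by case: (ord2P j) => ->; case: (ord2P i) => ->; rewrite /=; ring.
Qed.

End Matrix.

(** The eigenline depends on [j] alone, which is why at most two can occur. *)
Lemma shear_eigenline A j b : 0 < b ->
  (forall v : 'cV[R]_2,
    A *m v = spectral_radius A *: v + (b * coord v j 0) *: col (rev_ord j) P) ->
  dominant_eigenline A = [set v | coord v j 0 = 0].
Proof.
move=> b0 AE; apply/seteqP; split=> v /=; rewrite /dominant_eigenline /= AE; last first.
  by move=> ->; rewrite mulr0 scale0r addr0.
move/(canRL (addKr _)); rewrite addNr => /(congr1 (mulmx (invmx P))).
rewrite -scalemxAr mulmx0 colE mulKmx// => /matrixP/(_ (rev_ord j) 0).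
by rewrite !mxE !eqxx mulr1 => /eqP; rewrite mulf_eq0 gt_eqF// => /eqP.
Qed.

(** The coefficient of [u] in [A v] is [b] times the displayed quotient. As [b > 0], its sign
    depends only on [j], [u] and [v], which forces a common orientation. *)
Lemma shear_positively_associated A j b (u : 'cV[R]_2) : 0 < b ->
  (forall v : 'cV[R]_2,
    A *m v = spectral_radius A *: v + (b * coord v j 0) *: col (rev_ord j) P) ->
  u != 0 -> coord u j 0 = 0 ->
  positively_associated A u = [set v | 0 < coord v j 0 / coord u (rev_ord j) 0].
Proof.
move=> b0 AE u0 uj; set i := rev_ord j; set s := coord u i 0.
have uE : u = s *: col i P.
  rewrite -[LHS]coordK colE scalemxAr; congr (_ *m _).
  apply/matrixP => k l; rewrite ord1 [RHS]mxE [X in _ * X]mxE eqxx andbT.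
  case: (rev_ord2P j k) => ->; first by rewrite rev_ord2_neq mulr0.
  by rewrite eqxx mulr1.
have s0 : s != 0 by apply: contraNneq u0 => s0; rewrite uE s0 scale0r.
have cP0 : col i P != 0 by apply: contraNneq u0 => c0; rewrite uE c0 scaler0.
have Au : A *m u = spectral_radius A *: u by rewrite AE uj mulr0 scale0r addr0.
have lamE l : A *m u = l *: u -> l = spectral_radius A.
  rewrite Au => /eqP; rewrite -subr_eq0 -scalerBl scaler_eq0 (negPf u0) orbF subr_eq0.
  by move=> /eqP ->.
apply/seteqP; split=> v /=.
  move=> [l [x [/lamE-> + x0]]]; rewrite AE => /addrI.
  rewrite [in RHS]uE scalerA => /eqP; rewrite -subr_eq0 -scalerBl scaler_eq0 (negPf cP0) orbF.
  rewrite subr_eq0 => /eqP e; rewrite -(pmulr_rgt0 _ b0) mulrA e.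
  by rewrite mulfK.
move=> vs; exists (spectral_radius A), (b * (coord v j 0 / s)).
split=> //; last by rewrite mulr_gt0.
by rewrite AE [in RHS]uE scalerA -!mulrA mulVf// mulr1.
Qed.

End Orthant.

(** Invariance passes to products, so results on a single invariant matrix reach the whole of
    [family1 F]. *)
Lemma family1_invariant (R : realType) (F : set 'M[R]_2) (K : set 'cV[R]_2) :
  family_invariant F K -> family_invariant (family1 F) K.
Proof.
move=> FK A [/FK//|[B [C [FB FC _ -> _]]]] x Kx.
by rewrite -mulmxA; apply/(FK _ FB)/(FK _ FC).
Qed.

(** * Interiors of cones spanned by two vectors *)

Lemma Cone_pair_ge0 (R : realType) n (x y : 'cV[R]_n) (f : 'rV[R]_n) :
  0 <= (f *m x) 0 0 -> 0 <= (f *m y) 0 0 ->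
  forall z, Cone [set x; y] z -> 0 <= (f *m z) 0 0.
Proof.
move=> fx fy z [m [a [w [a0 ww ->]]]]; rewrite mulmx_sumr summxE sumr_ge0// => i _.
by rewrite -scalemxAr mxE mulr_ge0//; case: (ww i) => ->.
Qed.

(** From an interior point one can still move a little along [- w], which lowers [f] by a positive
    amount and keeps it nonnegative. *)
Lemma interior_pos (R : realType) n (U : set 'cV[R]_n) (f : 'rV[R]_n) (w v : 'cV[R]_n) :
  0 < (f *m w) 0 0 -> (forall z, U z -> 0 <= (f *m z) 0 0) ->
  U° v -> 0 < (f *m v) 0 0.
Proof.
move=> fw fU Uv; have [t t0 /fU] := nbhs_ray (- w) Uv.
rewrite mulmxDr -scalemxAr mulmxN [X in 0 <= X]mxE [X in _ + X]mxE [X in _ * X]mxE => h.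
have := mulr_gt0 t0 fw; lra.
Qed.

Section Separation.
Variables (R : realType) (P : 'M[R]_2).
Hypothesis Pu : P \in unitmx.

Let coordE i (v : 'cV[R]_2) : (row i (invmx P) *m v) 0 0 = (invmx P *m v) i 0.
Proof. by rewrite -row_mul mxE. Qed.

Let coord_col i j : (row i (invmx P) *m col j P) 0 0 = (i == j)%:R.
Proof. by rewrite coordE colE mulKmx// mxE eqxx andbT. Qed.

Lemma free_cols : free [:: col 0 P; col 1 P].
Proof.
apply/(@freeP _ _ 2 [tuple col 0 P; col 1 P]) => k; rewrite sum_ord2 /= => e.
have ki i : k i = 0.
  have := congr1 (fun x => (row i (invmx P) *m x) 0 0) e.
  rewrite mulmxDr -!scalemxAr mulmx0 [RHS]mxE [LHS]mxE.
  rewrite [X in X + _]mxE [X in _ + X]mxE !coord_col.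
  by case: (ord2P i) => ->; rewrite /= !(mulr0, mulr1, add0r, addr0).
exact: ki.
Qed.

(** The rows of [invmx P] are the coordinate functionals: each is nonnegative on both generators and
    equals 1 on one of them. *)
Lemma interior_Cone_cols v : (Cone [set col 0 P; col 1 P])° v ->
  0 < (invmx P *m v) 0 0 /\ 0 < (invmx P *m v) 1 0.
Proof.
by move=> Kv; split; rewrite -coordE; [apply: (@interior_pos _ _ _ _ (col 0 P)) Kv
  |apply: (@interior_pos _ _ _ _ (col 1 P)) Kv]; rewrite ?coord_col//;
  apply: Cone_pair_ge0; rewrite coord_col.
Qed.

Lemma interior_Cone_colsN v : (Cone [set col 0 P; - col 1 P])° v ->
  0 < (invmx P *m v) 0 0 /\ (invmx P *m v) 1 0 < 0.
Proof.
move=> Kv; split.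
  rewrite -coordE; apply: (@interior_pos _ _ _ _ (col 0 P)) Kv; rewrite ?coord_col//.
  by apply: Cone_pair_ge0; rewrite ?mulmxN ?coord_col// mxE coord_col oppr0.
have N (x : 'cV[R]_2) : ((- row 1 (invmx P)) *m x) 0 0 = - (invmx P *m x) 1 0.
  by rewrite mulNmx mxE coordE.
rewrite -oppr_gt0 -N; apply: (@interior_pos _ _ _ _ (- col 1 P)) Kv.
  by rewrite mulNmx mulmxN opprK coord_col.
by apply: Cone_pair_ge0; rewrite mulNmx ?mulmxN ?opprK ?coord_col// mxE coord_col oppr0.
Qed.

End Separation.

Theorem theorem7 (R : realType) (F : set 'M[R]_2) (finF : finite_set F) :
  (exists K : set 'cV[R]_2, proper_cone K /\ family_invariant F K) ->
  [/\ forall A, family1 F A -> vandergraft A,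
      ([set dominant_eigenline A | A in nondiagonalizable_in (family1 F)]
         #<= `I_2)
      /\ (forall A B : 'M[R]_2,
            nondiagonalizable_in (family1 F) A ->
            nondiagonalizable_in (family1 F) B ->
            dominant_eigenline A = dominant_eigenline B ->
            forall u, dominant_eigenvector A u -> same_orientation u A B)
    & separated (family1 F)].
Proof.
move=> [K [pK /family1_invariant FK]].
have [P Pu KP] := proper_cone_orthant pK.
pose L (j : 'I_2) : set 'cV[R]_2 := [set v | (invmx P *m v) j 0 = 0].
split.
- move=> A FA; have AK := FK _ FA. exact (invariant_vandergraft Pu KP AK).
- split.
    (* All these eigenlines lie in the image of a two-element set under [L]. *)
    apply: card_le_trans (card_image_le (fun n => L (inord n)) _).
    apply: subset_card_le => _ [A [/FK AK nd] <-].
    have [j [b [b0 AE]]] := invariant_shear Pu KP AK nd.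
    by exists j; [exact: ltn_ord|rewrite inord_val (shear_eigenline Pu b0 AE)].
  move=> A B [/FK AK ndA] [/FK BK ndB].
  have [i [a [a0 AE]]] := invariant_shear Pu KP AK ndA.
  have [j [b [b0 BE]]] := invariant_shear Pu KP BK ndB.
  rewrite (shear_eigenline Pu a0 AE) (shear_eigenline Pu b0 BE) => ij.
  (* Otherwise [col i P] would lie on [L j] but not on [L i]. *)
  have {ij} ij : i = j.
    case: (rev_ord2P j i) => // iE.
    have colE1 k : (invmx P *m col i P) k 0 = (k == i)%:R.
      by rewrite colE mulKmx// mxE eqxx andbT.
    have : L j (col i P) by rewrite /L /= colE1 iE rev_ord2_neq.
    by rewrite /L -ij /= colE1 eqxx => /eqP; rewrite oner_eq0.
  rewrite -ij in BE => u [_ _ u0]; rewrite (shear_eigenline Pu a0 AE) /= => ui.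
  by rewrite /same_orientation (shear_positively_associated Pu a0 AE u0 ui)
    (shear_positively_associated Pu b0 BE u0 ui).
(* The separating vectors are the edges of the invariant cone. *)
- exists (col 0 P), (col 1 P); split.
  + exact: free_cols.
  + by move=> A v /FK AK vA /(interior_Cone_cols Pu); apply: invariant_nondominant AK _ vA.
  + move=> A v /FK AK [_ nsA _ Av] /(interior_Cone_colsN Pu).
    exact: invariant_dominant AK _ nsA Av.
  + by move=> v [] -> _ A /FK AK; exact: invariant_nondominant_edge Pu KP _ AK _.
Qed.
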